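(* Let $G=(\mathcal V,\mathcal E)$ be an undirected connected graph with $\mathcal V=\{1,\dots,n\}$ and $|\mathcal E|=m$, and consider $\dot x=f(x)$ on $\mathbb{R}^n$ with $f$ continuously differentiable, solutions defined for all $t\ge0$, and $f(x+c\mathbf{1}_n)=f(x)$ for all $x\in\mathbb{R}^n$, $c\in\mathbb{R}$. Let $v\in\mathcal I_{\mathcal E}$ and let $B_v$ be as below. The following are equivalent: (i) for every $x\in\mathbb{R}^n$ there exists $P(x)\in\mathbb{M}_m$ with $B_v^{\top}D_xf(x)=P(x)B_v^{\top}$; (ii) for every two trajectories $x(t),y(t)$ with $B_v^{\top}x(0)\le B_v^{\top}y(0)$ one has $B_v^{\top}x(t)\le B_v^{\top}y(t)$ for all $t\ge0$. Additionally, if (i) holds, $c\in\mathbb{R}$, and $\mathbf{e}\in\mathbb{R}^n$ satisfies $B_v^{\top}\mathbf{e}>0_m$, then the following are equivalent: (iii) $B_v^{\top}D_xf(x)\mathbf{e}\le -cB_v^{\top}\mathbf{e}$ for all $x\in\mathbb{R}^n$; (iv) for every two trajectories $x(t),y(t)$ and all $t\ge0$, $\|\mathrm{diag}(B_v^{\top}\mathbf{e})^{-1}(B_v^{\top}x(t)-B_v^{\top}y(t))\|_\infty\le e^{-ct}\|\mathrm{diag}(B_v^{\top}\mathbf{e})^{-1}(B_v^{\top}x(0)-B_v^{\top}y(0))\|_\infty$.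
   Context: $\mathcal I_{\mathcal E}=\{v\in\mathbb{R}^n: v_i\ne v_j\text{ for every edge }\{i,j\}\in\mathcal E\}$. For $v\in\mathcal I_{\mathcal E}$, $B_v\in\mathbb{R}^{n\times m}$ is the incidence matrix of $G$ for an orientation of the edges chosen so that $B_v^{\top}v>0_m$; an incidence matrix has one column per edge, with entry $+1$ at the tail node, $-1$ at the head node, and $0$ elsewhere (so $B_v^{\top}x$ is the vector of edge differences $x_i-x_j$). $\mathbb{M}_m$ is the set of $m\times m$ Metzler matrices (nonnegative off-diagonal entries). Inequalities between vectors are entrywise; $\mathbf 1_n$ is the all-ones vector. *)

(* Defs.v *)
From HB Require Import structures.
From mathcomp Require Import all_boot all_order all_algebra.
From mathcomp Require Import all_classical all_reals all_analysis.
Set Implicit Arguments. Unset Strict Implicit. Unset Printing Implicit Defensive.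
Import Order.TTheory GRing.Theory Num.Theory.
Import numFieldNormedType.Exports.
Local Open Scope ring_scope.
Local Open Scope classical_set_scope.

(* Undirected simple graph on vertices 'I_n with m edges, edge k being the
   unordered pair {(E k).1, (E k).2}. *)
Definition simple_edges (n m : nat) (E : 'I_m -> 'I_n * 'I_n) : Prop :=
  (forall k, (E k).1 != (E k).2) /\
  (forall k l, k != l -> E k != E l /\ E k != ((E l).2, (E l).1)).

Definition adj (n m : nat) (E : 'I_m -> 'I_n * 'I_n) : rel 'I_n :=
  fun i j => [exists k, (E k == (i, j)) || (E k == (j, i))].

Definition graph_connected (n m : nat) (E : 'I_m -> 'I_n * 'I_n) : Prop :=
  forall i j : 'I_n, connect (adj E) i j.

Definition in_IE (R : realType) (n m : nat) (E : 'I_m -> 'I_n * 'I_n)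
  (v : 'cV[R]_n) : Prop :=
  forall k, v (E k).1 0 != v (E k).2 0.

(* Incidence matrix B_v (n x m): for edge k = {a,b}, the tail is the endpoint
   with the larger v-value (+1), the head the other one (-1), so B_v^T v > 0
   whenever v \in I_E. *)
Definition Bv (R : realType) (n m : nat) (E : 'I_m -> 'I_n * 'I_n)
  (v : 'cV[R]_n) : 'M[R]_(n, m) :=
  \matrix_(i, k)
    (let a := (E k).1 in let b := (E k).2 in
     let tl := if v b 0 < v a 0 then a else b in
     let hd := if v b 0 < v a 0 then b else a in
     if i == tl then 1 else if i == hd then -1 else 0).

Definition mx_le (R : realType) p q (A B : 'M[R]_(p, q)) : Prop :=
  forall i j, A i j <= B i j.
Definition mx_pos (R : realType) p q (A : 'M[R]_(p, q)) : Prop :=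
  forall i j, 0 < A i j.

Definition metzler (R : realType) m (P : 'M[R]_m) : Prop :=
  forall i j, i != j -> 0 <= P i j.

(* Usual Jacobian matrix D_x f(x), entries (i,j) = d f_i / d x_j.
   States are stored as row vectors 'rV_n (MathComp-Analysis convention),
   whose library jacobian acts by right multiplication, hence the transpose. *)
Definition Dx (R : realType) n (f : 'rV[R]_n -> 'rV[R]_n) (x : 'rV[R]_n)
  : 'M[R]_n := (jacobian f x)^T.

Definition col_of (R : realType) n (x : 'rV[R]_n) : 'cV[R]_n := x^T.

Definition C1 (R : realType) n (f : 'rV[R]_n -> 'rV[R]_n) : Prop :=
  (forall x, differentiable f x) /\ continuous (jacobian f).

Definition trajectory (R : realType) n (f : 'rV[R]_n -> 'rV[R]_n)
  (x : R -> 'rV[R]_n) : Prop :=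
  {within `[0, +oo[, continuous x} /\
  (forall t : R, 0 < t -> is_derive t 1 x (f (x t))) /\
  ((fun h : R => h^-1 *: (x h - x 0)) @ 0^'+ --> f (x 0)).

Definition forward_complete (R : realType) n (f : 'rV[R]_n -> 'rV[R]_n) : Prop :=
  forall x0, exists x, trajectory f x /\ x 0 = x0.

Definition shift_invariant (R : realType) n (f : 'rV[R]_n -> 'rV[R]_n) : Prop :=
  forall x (c : R), f (x + c *: const_mx 1) = f x.

(* weighted infinity norm || diag(w)^{-1} u ||_oo  (u, w column vectors);
   the norm on 'cV[R]_m is the library's max-norm on matrices. *)
Definition wnorm (R : realType) m (w u : 'cV[R]_m) : R :=
  `| invmx (diag_mx w^T) *m u |.

(* Main.v *)
(* With K = {z : B^T z >= 0}, Farkas' lemma applied to each row turns (i) into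
   the pointwise condition: if z is in K and (B^T z)_k = 0, then
   (B^T Df(p) z)_k >= 0. This condition involves no choice of P(x), so nothing
   is needed about the regularity of P. It yields a comparison principle: if x
   is a trajectory and B^T Y' >= B^T f(Y), then B^T x <= B^T Y propagates in
   time. To prove it, perturb Y - x by eps e^{K(t - T)} v, which is interior to
   K; at a first time where a coordinate of the perturbed difference vanishes,
   the mean value theorem along the segment and a local Lipschitz bound on f in
   the direction v show that its derivative is positive, a contradiction.
   Taking Y = y gives (ii), and Y(t) = y(t) + r e^{-ct} e gives (iv), as (iii)
   makes this Y a supersolution. The converses follow by differentiating the
   inequalities at t = 0 along trajectories from p and p + h z. *)
Require Import Defs.
From HB Require Import structures.
From mathcomp Require Import all_boot all_order all_algebra.
From mathcomp Require Import all_classical all_reals all_analysis.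
From mathcomp Require Import ring lra.
Import Order.TTheory GRing.Theory Num.Theory.
Import numFieldNormedType.Exports.
Local Open Scope ring_scope.

Section MonotoneFlows.
Local Open Scope classical_set_scope.

(** * Farkas' lemma *)

(** Induction on the number of generators. If the first constraint is redundant, the induction
    hypothesis applies as is. Otherwise some [z0] meets all other constraints with [dot a z0 < 0],
    hence violates the first one, and projecting along [z0] removes that generator. *)
Lemma farkas (F : realFieldType) (n m : nat) (A : 'I_m -> 'rV[F]_n)
  (a : 'rV[F]_n) :
  (forall z : 'cV[F]_n, (forall i, 0 <= (A i *m z) 0 0) ->
    0 <= (a *m z) 0 0) ->
  exists2 u : 'I_m -> F, forall i, 0 <= u i & a = \sum_i u i *: A i.
Proof.
elim: m => [|m IHm] in A a *.
  move=> a_ge0; exists (fun=> 0) => //; rewrite big_ord0.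
  apply/rowP => j; rewrite mxE.
  have : 0 <= (a *m - a^T) 0 0 by apply: a_ge0; case.
  rewrite mulmxN !mxE oppr_ge0 => sum_le0.
  have sq_ge0 i : 0 <= a 0 i * a^T i 0 by rewrite mxE -expr2 sqr_ge0.
  have : \sum_i a 0 i * a^T i 0 == 0.
    by rewrite eq_le sum_le0 sumr_ge0.
  rewrite psumr_eq0 // => /allP/(_ j); rewrite mem_index_enum mxE.
  by move=> /(_ isT) /=; rewrite mulf_eq0 orbb => /eqP.
pose dot (b : 'rV[F]_n) (z : 'cV[F]_n) := (b *m z) 0 0.
have dotBl b b' z : dot (b - b') z = dot b z - dot b' z.
  by rewrite /dot mulmxBl mxE [X in _ + X]mxE.
have dotBr b z z' : dot b (z - z') = dot b z - dot b z'.
  by rewrite /dot mulmxBr mxE [X in _ + X]mxE.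
have dotZl c b z : dot (c *: b) z = c * dot b z.
  by rewrite /dot -scalemxAl mxE.
have dotZr c b z : dot b (c *: z) = c * dot b z.
  by rewrite /dot -scalemxAr mxE.
move=> a_ge0.
case: (pselect (forall z : 'cV[F]_n,
    (forall i : 'I_m, 0 <= dot (A (lift ord0 i)) z) -> 0 <= dot a z)).
  move=> /IHm[u u_ge0 ->].
  exists (fun i => if unlift ord0 i is Some j then u j else 0).
    by move=> i; case: unliftP.
  rewrite big_ord_recl unlift_none scale0r add0r.
  by apply: eq_bigr => i _; rewrite liftK.
move/existsNP => [z0 /not_implyP[z0P /negP]]; rewrite -ltNge => az0.
have d_lt0 : dot (A ord0) z0 < 0.
  rewrite ltNge; apply/negP => d_ge0; move: az0; rewrite ltNge a_ge0 // => i.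
  by case: (unliftP ord0 i) => [j|] ->; [exact: z0P | exact: d_ge0].
set d := dot (A ord0) z0 in d_lt0.
have d_neq0 : d != 0 by rewrite lt_eqF.
(* By [subE], testing [sub b] on z amounts to testing b on the projection of z
   along z0 onto the kernel of [A ord0], where that constraint is void. *)
pose sub (b : 'rV[F]_n) := b - (dot b z0 / d) *: A ord0.
have subE b z : dot (sub b) z = dot b (z - (dot (A ord0) z / d) *: z0).
  by rewrite /sub dotBl dotBr dotZl dotZr; ring.
have [z zP|u u_ge0 ua] := IHm (fun i => sub (A (lift ord0 i))) (sub a).
  rewrite -/(dot _ _) subE; apply: a_ge0 => i.
  case: (unliftP ord0 i) => [j|] ->; rewrite -/(dot _ _).
    by rewrite -subE; exact: zP.
  by rewrite dotBr dotZr -/d divfK // subrr.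
(* [u0] collects the multiples of [A ord0] released on undoing the projections. It is nonnegative
   because [dot a z0] and [d] are negative while [z0] satisfies the other constraints. *)
pose u0 := dot a z0 / d - \sum_i u i * (dot (A (lift ord0 i)) z0 / d).
exists (fun i => if unlift ord0 i is Some j then u j else u0).
  move=> i; case: unliftP => // _.
  rewrite /u0 subr_ge0; apply: (@le_trans _ _ 0).
    apply: sumr_le0 => j _; apply: mulr_ge0_le0 => //.
    by apply: mulr_ge0_le0; [exact: z0P | rewrite invr_le0 ltW].
  by rewrite mulr_le0 // ?invr_le0 ltW.
rewrite big_ord_recl unlift_none.
under eq_bigr do rewrite liftK.
have -> : a = sub a + (dot a z0 / d) *: A ord0 by rewrite subrK.
rewrite {1}ua {}/u0 {subE ua}/sub.
rewrite (eq_bigr (fun i => u i *: A (lift ord0 i)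
    - (u i * (dot (A (lift ord0 i)) z0 / d)) *: A ord0)); last first.
  by move=> i _; rewrite scalerBr scalerA.
by rewrite sumrB -scaler_suml scalerBl addrAC [RHS]addrC addrA.
Qed.

(** * Difference quotients and edge coordinates *)

Lemma is_derive_cvg {R : numFieldType} {V W : normedModType R}
  (f : V -> W) (a v : V) df :
  is_derive a v f df <-> h^-1 *: (f (h *: v + a) - f a) @[h --> 0^'] --> df.
Proof.
split=> [[fd <-]|fdf]; first exact: fd.
by split; [apply/cvg_ex; exists df | apply/cvg_lim].
Qed.

Section EdgeCoordinates.
Context {R : realType} {n m : nat}.
Implicit Types (B : 'M[R]_(n, m)) (u w p : 'rV[R]_n) (k : 'I_m).

(** For an incidence matrix, the difference of [u] across edge [k]. States are row vectors, so [B]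
    acts on the right. *)
Definition ecoord B k u : R := (u *m B) 0 k.

Lemma ecoordD B k u w : ecoord B k (u + w) = ecoord B k u + ecoord B k w.
Proof. by rewrite /ecoord mulmxDl mxE. Qed.

Lemma ecoordB B k u w : ecoord B k (u - w) = ecoord B k u - ecoord B k w.
Proof. by rewrite /ecoord mulmxBl mxE [X in _ + X]mxE. Qed.

Lemma ecoordBC B k u w : ecoord B k (u - w) = - ecoord B k (w - u).
Proof. by rewrite !ecoordB opprB. Qed.

Lemma ecoordZ B k a u : ecoord B k (a *: u) = a * ecoord B k u.
Proof. by rewrite /ecoord -scalemxAl mxE. Qed.

Lemma ecoord_tr B k (u : 'cV[R]_n) : (B^T *m u) k 0 = ecoord B k u^T.
Proof. by rewrite /ecoord -[u in LHS]trmxK -trmx_mul mxE. Qed.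

Lemma continuous_ecoord B k : continuous (ecoord B k).
Proof.
have -> : ecoord B k = fun u => \sum_i u 0 i * B i k.
  by apply/funext => u; rewrite /ecoord mxE.
apply: continuous_big => [|i _]; first exact: add_continuous.
move=> u; have cu := @coord_continuous R 1 n 0 i u.
by apply: (cvgM cu); exact: cvg_cst.
Qed.

Lemma is_derive_ecoord B k (x : R -> 'rV[R]_n) (t : R) dx :
  is_derive t 1 x dx -> is_derive t 1 (ecoord B k \o x) (ecoord B k dx).
Proof.
move=> /is_derive_cvg xdx; apply/is_derive_cvg.
have := cvg_comp _ _ xdx (@continuous_ecoord B k dx).
apply: cvg_trans; apply: near_eq_cvg; near=> h.
by rewrite /= ecoordZ ecoordB.
Unshelve. all: by end_near. Qed.

End EdgeCoordinates.

(** * Positivity up to a first hitting time *)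

(** Let [s] be the infimum of the times at which some coordinate is nonpositive. By continuity all
    coordinates are nonnegative at [s] and one is zero; its positive derivative makes it negative
    just before [s], where all are still positive. *)
Lemma positive_barrier {R : realType} {m : nat} (g : 'I_m -> R -> R) (T : R) :
  (forall k, g k t @[t --> 0^'+] --> g k 0) ->
  (forall k t, 0 < t -> {for t, continuous (g k)}) ->
  (forall k, 0 < g k 0) ->
  (forall k t, 0 < t <= T -> (forall j, 0 <= g j t) -> g k t = 0 ->
    exists2 d, is_derive t 1 (g k) d & 0 < d) ->
  forall k t, 0 <= t <= T -> 0 < g k t.
Proof.
move=> g0_cvg g_cont g0_gt0 g_der k0 t0 t0T.
rewrite ltNge; apply/negP => gt0_le0.
pose A := [set t | 0 <= t <= T /\ exists k, g k t <= 0].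
have At0 : A t0 by split => //; exists k0.
have A_lb : lbound A 0 by move=> t [/andP[]].
have A_inf : has_inf A by split; [exists t0 | exists 0].
pose s := inf A.
have s_le t : A t -> s <= t by apply: ge_inf; case: A_inf.
have s_leT : s <= T by apply: (le_trans (s_le _ At0)); case/andP: t0T.
have before k t : 0 <= t < s -> 0 < g k t.
  move=> /andP[t_ge0 ts]; rewrite ltNge; apply/negP => gt_le0.
  suff /s_le : A t by rewrite leNgt ts.
  by split; [rewrite t_ge0 (le_trans (ltW ts)) | exists k].
have s_gt0 : 0 < s.
  have : \forall t \near 0^'+, forall k, 0 < g k t.
    by apply: filter_forall => k; apply: (cvgr_gt _ (g0_cvg k)).
  rewrite /at_right near_withinE => /nbhs_ballP[e /= e_gt0 eP].
  apply: (lt_le_trans e_gt0); apply: lb_le_inf; first by exists t0.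
  move=> t [/andP[t_ge0 _] [k gt_le0]]; rewrite leNgt; apply/negP => te.
  move: gt_le0; rewrite leNgt => /negP; apply.
  move: t_ge0; rewrite le_eqVlt => /predU1P[<- //|t_gt0].
  by apply: eP => //; rewrite /ball /= sub0r normrN gtr0_norm.
(* Half of the minimum gives a time within [e] of [s] that is still nonnegative, hence covered by
   [before]. *)
have left_pt e : 0 < e -> exists2 h, 0 < h & h < e /\ 0 <= s - h < s.
  move=> e_gt0; exists (Num.min e s / 2).
    by rewrite divr_gt0 // lt_min e_gt0.
  have m_gt0 : 0 < Num.min e s by rewrite lt_min e_gt0.
  have [me ms] : Num.min e s <= e /\ Num.min e s <= s.
    by rewrite !ge_min !lexx orbT.
  by split; lra.
have gs_ge0 k : 0 <= g k s.
  rewrite leNgt; apply/negP => gs_lt0.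
  have : \forall t \near s, g k t < 0 by apply: (cvgr_lt _ (g_cont k s s_gt0)).
  move=> /nbhs_ballP[e /= e_gt0 eP].
  have [h h_gt0 [he hs]] := left_pt _ e_gt0.
  have : g k (s - h) < 0.
    by apply: eP; rewrite /ball /= opprB addrC subrK gtr0_norm.
  by rewrite ltNge ltW // before.
have [k gks] : exists k, g k s <= 0.
  apply: contrapT => /forallNP gs_gt0.
  have near_gt0 k : \forall t \near s, 0 < g k t.
    apply: (cvgr_gt _ (g_cont k s s_gt0)).
    by rewrite ltNge; apply/negP; exact: gs_gt0.
  have : \forall t \near s, forall k, 0 < g k t.
    exact: (@filter_forall _ _ (fun k t => 0 < g k t) (nbhs s) _ near_gt0).
  move=> /nbhs_ballP[e /= e_gt0 eP].
  have [t At ts] := inf_adherent e_gt0 A_inf.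
  have [_ [k gt_le0]] := At; move: gt_le0; rewrite leNgt => /negP; apply.
  apply: eP; rewrite /ball /= ltr_distlC; apply/andP; split => //.
  by have := s_le _ At; lra.
have gks0 : g k s = 0 by apply/eqP; rewrite eq_le gks gs_ge0.
have sT : 0 < s <= T by rewrite s_gt0.
have [d /is_derive_cvg gd d_gt0] := g_der k s sT gs_ge0 gks0.
have : \forall h \near 0^', 0 < h^-1 *: (g k (h *: 1 + s) - g k s).
  exact: (cvgr_gt _ gd).
rewrite /dnbhs near_withinE => /nbhs_ballP[e /= e_gt0 eP].
have [h h_gt0 [he hs]] := left_pt _ e_gt0.
(* The quotient is tested at the negative increment [- h]: as [g k s = 0], its positivity forces
   [g k (s - h) < 0]. *)
have /eP : ball 0 e (- h) by rewrite /ball /= sub0r opprK gtr0_norm.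
rewrite oppr_eq0 gt_eqF // => /(_ isT).
rewrite gks0 subr0 /GRing.scale /= mulr1 addrC.
rewrite nmulr_rgt0 ?invr_lt0 ?oppr_lt0 //.
by rewrite ltNge ltW // before.
Qed.

(** * Mean values and bounds for the Jacobian *)

Section MeanValue.
Context {R : realType} {n m : nat}.
Variable f : 'rV[R]_n -> 'rV[R]_n.
Implicit Types (B : 'M[R]_(n, m)) (u w p : 'rV[R]_n) (k : 'I_m).

(** The scalar mean value theorem along the segment from [p] to [p + w]. The intermediate point
    depends on [k], so the equality holds one coordinate at a time. *)
Lemma ecoord_mean_value B k p w : (forall q, differentiable f q) ->
  exists2 s, 0 <= s <= 1 &
    ecoord B k (f (p + w) - f p)
    = ecoord B k (w *m jacobian f (p + s *: w)).
Proof.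
move=> df.
pose F (s : R) : R := ecoord B k (f (p + s *: w)).
pose dF (s : R) : R := ecoord B k (w *m jacobian f (p + s *: w)).
have FdF (s : R) : is_derive s 1 F (dF s).
  apply: (@is_derive_ecoord R n m B k (fun s => f (p + s *: w))).
  rewrite -deriveEjacobian //.
  have /is_derive_cvg : is_derive (p + s *: w) w f ('D_w f (p + s *: w)).
    by split => //; apply: diff_derivable.
  move=> fdf; apply/is_derive_cvg; apply: cvg_trans fdf; apply: near_eq_cvg.
  near=> h; congr (_ *: (f _ - _)).
  by rewrite [h *: 1]mulr1 scalerDl addrCA.
have cF : {within `[0, 1], continuous F}.
  by apply: derivable_within_continuous => s _; have [] := FdF s.
have [s] := @MVT_segment R F dF 0 1 ler01 (fun s _ => FdF s) cF.
rewrite in_itv /= => s01 sF.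
exists s => //; move: sF; rewrite /F subr0 mulr1 scale1r scale0r addr0 => sF.
by rewrite ecoordB -/(dF s) -sF.
Unshelve. all: by end_near. Qed.

(** Continuity on the compact product of [K] with the unit interval. Combined with mean values, this
    is a one-sided Lipschitz bound along [w], uniform over [K]. *)
Lemma jacobian_bounded B k w (K : set 'rV[R]_n) : continuous (jacobian f) ->
  compact K -> exists L, forall p s, K p -> 0 <= s <= 1 ->
    ecoord B k (w *m jacobian f (p + s *: w)) <= L.
Proof.
move=> cJ cK.
pose H (q : 'rV[R]_n * R) : R := ecoord B k (w *m jacobian f (q.1 + q.2 *: w)).
have cH : continuous H.
  have -> : H = fun q =>
      \sum_i \sum_j w 0 j * jacobian f (q.1 + q.2 *: w) j i * B i k.
    apply/funext => q; rewrite /H /ecoord mxE; apply: eq_bigr => i _.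
    by rewrite mxE mulr_suml.
  apply: continuous_big => [|i _]; first exact: add_continuous.
  apply: continuous_big => [|j _]; first exact: add_continuous.
  move=> q.
  have cq : (q.1 + q.2 *: w) @[q --> q] --> q.1 + q.2 *: w.
    apply: cvgD; first exact: cvg_fst.
    by apply: cvgZr_tmp; exact: cvg_snd.
  have cJq := cvg_comp _ _ cq (cJ (q.1 + q.2 *: w)).
  have cJij := cvg_comp _ _ cJq
    (@coord_continuous R n n j i (jacobian f (q.1 + q.2 *: w))).
  have := cvgM (cvgM (cvg_cst (w 0 j)) cJij) (cvg_cst (B i k)).
  exact.
have cKI := compact_setX cK (@segment_compact R 0 1).
have /compact_bounded/pinfty_ex_gt0[L _ HL] :=
  @continuous_compact _ _ _ _ (@continuous_subspaceT _ _ _ _ cH) cKI.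
exists L => p s Kp s01; apply: le_trans (ler_norm _) (HL _ _).
by exists (p, s) => //=; split => //=; rewrite in_itv.
Qed.
End MeanValue.

(** * Derivatives of exponential perturbations *)

Lemma is_derive_expR_affine {R : realType} (a c T t : R) :
  is_derive t 1 (fun t => a * expR (c * (t - T)))
    (c * (a * expR (c * (t - T)))).
Proof.
have aff : is_derive t 1 (fun t => c * (t - T)) c.
  have -> : (fun t => c * (t - T)) = c \*: (id - cst T).
    by apply/funext => s.
  by apply: is_derive_eq; rewrite subr0 [_ *: _]mulr1.
have comp := @is_derive1_comp R expR (fun t => c * (t - T)) t _ _
  (is_derive_expR _) aff.
have -> : (fun t => a * expR (c * (t - T)))
    = a \*: (expR \o fun t => c * (t - T)).
  by [].
by apply: is_derive_eq; rewrite [_ *: _]mulrA [RHS]mulrC.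
Qed.

Lemma is_derive_scaler {R : realType} {V : normedModType R}
  (s : R -> R) (v : V) (t ds : R) :
  is_derive t 1 s ds -> is_derive t 1 (fun t => s t *: v) (ds *: v).
Proof.
move=> /is_derive_cvg sds; apply/is_derive_cvg.
rewrite (_ : (fun h => _) =
  fun h => (h^-1 *: (s (h *: 1 + t) - s t)) *: v); first exact: cvgZr_tmp.
by apply/funext => h; rewrite -scalerBl scalerA.
Qed.

Lemma is_derive_continuous {R : realType} {V : normedModType R}
  (x : R -> V) (t : R) dx :
  is_derive t 1 x dx -> {for t, continuous x}.
Proof.
by move=> [xt _]; apply: differentiable_continuous; apply/derivable1_diffP.
Qed.

(** * Comparison principle *)

Section Comparison.
Context {R : realType} {n m : nat}.
Variables (f : 'rV[R]_n -> 'rV[R]_n) (B : 'M[R]_(n, m)).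

(** Kamke's condition for the cone of nonnegative edge coordinates: on the face where coordinate [k]
    vanishes, the linearized field does not point out through that face. *)
Definition quasimonotone := forall (p z : 'rV[R]_n) k,
  (forall j, 0 <= ecoord B j z) -> ecoord B k z = 0 ->
  0 <= ecoord B k (z *m jacobian f p).

(** Stated for a supersolution [Y], to serve both a second trajectory and a trajectory shifted by an
    exponential multiple of [e]. *)
Lemma comparison (v : 'rV[R]_n) (x Y dY : R -> 'rV[R]_n) :
  C1 f -> quasimonotone -> (forall k, 0 < ecoord B k v) ->
  {within `[0, +oo[, continuous x} -> {within `[0, +oo[, continuous Y} ->
  (forall t : R, 0 < t -> is_derive t 1 x (f (x t))) ->
  (forall t : R, 0 < t -> is_derive t 1 Y (dY t)) ->
  (forall (t : R) k, 0 < t -> ecoord B k (f (Y t)) <= ecoord B k (dY t)) ->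
  (forall k, ecoord B k (x 0) <= ecoord B k (Y 0)) ->
  forall (t : R) k, 0 <= t -> ecoord B k (x t) <= ecoord B k (Y t).
Proof.
move=> [df cJ] qm v_gt0 cx cY dx dYP sup xY0 T k0 T_ge0.
have cY0T : compact (Y @` `[0, T]).
  apply: continuous_compact (@segment_compact _ 0 T).
  apply: continuous_subspaceW cY => t /=.
  by rewrite !in_itv /= andbT => /andP[].
have /choice[L LP] : forall k, exists L, forall p s,
    (Y @` `[0, T]) p -> 0 <= s <= 1 ->
    ecoord B k (v *m jacobian f (p + s *: v)) <= L.
  by move=> k; exact: jacobian_bounded.
have [K K_ge0 KP] : exists2 K, 0 <= K & forall k, L k < K * ecoord B k v.
  (* Summing over the edges gives one rate for all: the [k]-th term alone contributes [|L k| + 1] to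
     [K * ecoord B k v]. *)
  exists (\sum_k (`|L k| + 1) / ecoord B k v) => [|k].
    by apply: sumr_ge0 => j _; rewrite divr_ge0 ?(ltW (v_gt0 j)) // addr_ge0.
  rewrite (bigD1 k) //= mulrDl divfK ?gt_eqF //.
  apply: (@lt_le_trans _ _ (`|L k| + 1)); first by rewrite ltr_pwDr // ler_norm.
  rewrite lerDl mulr_ge0 ?(ltW (v_gt0 k)) //; apply: sumr_ge0 => j _.
  by rewrite divr_ge0 ?(ltW (v_gt0 j)) // addr_ge0.
(* The perturbation has size [e] at time [T], so a negative gap at [T] is refuted by a small [e].
   The bound [e <= 1] keeps [S t] in the unit interval, where the constants [L] are valid. *)
suff claim e : 0 < e <= 1 -> 0 < ecoord B k0 (Y T - x T) + e * ecoord B k0 v.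
  rewrite -subr_ge0 -ecoordB leNgt; apply/negP => W_lt0.
  pose e := Num.min 1 (- ecoord B k0 (Y T - x T) / ecoord B k0 v).
  have e1 : 0 < e <= 1 by rewrite lt_min ge_min lexx ltr01 divr_gt0 // oppr_gt0.
  have := claim e e1; rewrite ltNge => /negP; apply.
  by rewrite addrC -lerBrDr sub0r -ler_pdivlMr // ge_min lexx orbT.
move=> /andP[e_gt0 e_le1].
pose S t := e * expR (K * (t - T)).
pose z t := Y t - x t + S t *: v.
have S_gt0 t : 0 < S t by rewrite mulr_gt0 // expR_gt0.
have ST : S T = e by rewrite /S subrr mulr0 expR0 mulr1.
suff : 0 < ecoord B k0 (z T) by rewrite /z ecoordD ecoordZ ST.
have dS (t : R) : is_derive t 1 S (K * S t) by exact: is_derive_expR_affine.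
have dz (t : R) : 0 < t -> is_derive t 1 z (dY t - f (x t) + (K * S t) *: v).
  move=> t_gt0; exact: is_deriveD (is_deriveB (dYP t t_gt0) (dx t t_gt0))
    (is_derive_scaler S v t _ (dS t)).
pose g k t := ecoord B k (z t).
apply: (@positive_barrier R m g T) =>
  [k|k t t_gt0|k|k t /andP[t_gt0 tT] gt_ge0 gkt|].
- suff z0 : z t @[t --> 0^'+] --> z 0.
    exact: (cvg_comp _ _ z0 (@continuous_ecoord R n m B k (z 0))).
  have [_ Y0] := (continuous_within_itvcyP _ _).1 cY.
  have [_ x0] := (continuous_within_itvcyP _ _).1 cx.
  apply: cvgD; first exact: cvgB.
  apply: cvgZr_tmp; apply: cvg_at_right_filter.
  exact: is_derive_continuous (dS 0).
- apply: (@is_derive_continuous _ _ (g k)).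
  exact: (is_derive_ecoord _ _ _ _ _ (dz _ t_gt0)).
- rewrite /g /z ecoordD ecoordB ecoordZ ltr_wpDl ?subr_ge0 //.
  by rewrite mulr_gt0.
- exists (ecoord B k (dY t - f (x t) + (K * S t) *: v)).
    exact: (is_derive_ecoord _ _ _ _ _ (dz _ t_gt0)).
  have St1 : S t <= 1.
    rewrite -[leRHS]mulr1; apply: ler_pM e_le1 _;
      rewrite ?(ltW e_gt0) ?expR_ge0 //.
    by rewrite -expR0 ler_expR mulr_ge0_le0 // subr_le0.
  (* The same point is reached twice: from [x t] by [z t], where quasimonotonicity gives a sign, and
     from [Y t] by [S t *: v], where the Lipschitz bound applies. *)
  have [s s01 fz] := ecoord_mean_value f B k (x t) (z t) df.
  have [s' s'01 fv] := ecoord_mean_value f B k (Y t) (S t *: v) df.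
  have zk_ge0 : 0 <= ecoord B k (f (x t + z t) - f (x t)).
    by rewrite fz; exact: qm.
  have xz : x t + z t = Y t + S t *: v by rewrite /z addrA subrKC.
  have fv_lt : ecoord B k (f (Y t + S t *: v) - f (Y t))
      < K * S t * ecoord B k v.
    rewrite fv -scalemxAl ecoordZ [K * S t]mulrC -[ltRHS]mulrA ltr_pM2l //.
    apply: le_lt_trans (KP k); rewrite scalerA; apply: LP.
      by exists t => //=; rewrite in_itv /= (ltW t_gt0).
    move: s'01 => /andP[s'_ge0 s'_le1].
    rewrite mulr_ge0 ?(ltW (S_gt0 t)) //=.
    by rewrite -[leRHS]mulr1 ler_pM // (ltW (S_gt0 t)).
  move: zk_ge0 fv_lt (sup t k t_gt0).
  rewrite xz [ecoord B k (dY t - _ + _)]ecoordD !ecoordB ecoordZ subr_ge0 ltrBlDr.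
  move=> zk_ge0 fv_lt dY_ge.
  rewrite addrAC subr_gt0; apply: (le_lt_trans zk_ge0).
  by apply: (lt_le_trans fv_lt); rewrite [leRHS]addrC lerD2l.
- by rewrite T_ge0 lexx.
Qed.
End Comparison.

(** * Metzler factorization and the weighted norm *)

(** Forwards, the diagonal entry of row [k] is multiplied by [ecoord B k z = 0] and the other terms
    are nonnegative. Conversely, Farkas' lemma for each column of [A *m B] yields a row of [P]. *)
Lemma metzler_factorP {R : realType} {n m : nat} (B : 'M[R]_(n, m))
  (A : 'M[R]_n) :
  (exists P : 'M[R]_m, metzler P /\ B^T *m A^T = P *m B^T) <->
  (forall z k, (forall j, 0 <= ecoord B j z) -> ecoord B k z = 0 ->
    0 <= ecoord B k (z *m A)).
Proof.
split=> [[P [PM PB]] z k z_ge0 zk0|qm].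
  have -> : ecoord B k (z *m A) = \sum_j ecoord B j z * P k j.
    rewrite /ecoord -mulmxA -[A *m B]trmxK trmx_mul PB trmx_mul trmxK.
    rewrite mulmxA mxE.
    by apply: eq_bigr => j _; rewrite [P^T _ _]mxE.
  apply: sumr_ge0 => j _.
  have [->|jk] := eqVneq j k; first by rewrite zk0 mul0r.
  by rewrite mulr_ge0 // PM // eq_sym.
have colE (C : 'M[R]_(n, m)) j (z : 'cV[R]_n) : ((col j C)^T *m z) 0 0
    = ecoord C j z^T.
  by rewrite /ecoord !mxE; apply: eq_bigr => i _; rewrite !mxE mulrC.
have /choice[u uP] k : exists u : 'I_m.+1 -> R, (forall i, 0 <= u i) /\
    (col k (A *m B))^T = - u ord0 *: (col k B)^T
      + \sum_j u (lift ord0 j) *: (col j B)^T.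
  (* The extra generator, minus column [k], makes the constraint on coordinate [k] an equality. Its
     multiplier enters [P] only on the diagonal, where a Metzler matrix may have any sign. *)
  pose F (i : 'I_m.+1) :=
    if unlift ord0 i is Some j then (col j B)^T else - (col k B)^T.
  have [z zF|u u_ge0 uF] := @farkas R n m.+1 F (col k (A *m B))^T.
    have z_ge0 j : 0 <= ecoord B j z^T.
      by have := zF (lift ord0 j); rewrite /F liftK colE.
    rewrite colE /ecoord mulmxA; apply: qm => //.
    apply/eqP; rewrite eq_le z_ge0.
    by have := zF ord0; rewrite /F unlift_none mulNmx mxE colE oppr_ge0 => ->.
  exists u; split=> //; rewrite uF big_ord_recl /F unlift_none scalerN -scaleNr.
  by congr (_ + _); apply: eq_bigr => j _; rewrite liftK.
exists (\matrix_(k, j) (u k (lift ord0 j) - (j == k)%:R * u k ord0)); split.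
  move=> k j kj; rewrite mxE eq_sym (negbTE kj) mul0r subr0.
  by have [+ _] := uP k; apply.
apply/matrixP => k l; rewrite -trmx_mul.
rewrite mxE (_ : (A *m B) l k = (col k (A *m B))^T 0 l); last first.
  by rewrite [RHS]mxE [RHS]mxE.
rewrite (uP k).2 !mxE summxE.
under [RHS]eq_bigr => j _ do rewrite !mxE mulrBl -mulrA.
rewrite sumrB [X in _ - X](bigD1 k) //= eqxx mul1r.
rewrite [X in _ - (_ + X)]big1; last first.
  by move=> j /negPf ->; rewrite mul0r.
rewrite addr0 addrC mulNr; congr (_ - _).
by apply: eq_bigr => j _; rewrite !mxE.
Qed.

(** The norm is the maximum of the quotients of [|u k 0|] by [w k 0]; [0 <= r] covers the initial
    value 0 of that maximum, which is the norm itself when [m] is 0. *)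
Lemma wnorm_le {R : realType} {m : nat} (w u : 'cV[R]_m) (r : R) :
  mx_pos w -> 0 <= r ->
  (wnorm w u <= r) <-> forall k, `|u k 0| <= r * w k 0.
Proof.
move=> w_gt0 r_ge0; rewrite /wnorm.
pose q := \col_k (u k 0 / w k 0).
have uE : diag_mx w^T *m q = u.
  apply/matrixP => k j; rewrite mul_diag_mx !mxE ord1 mulrC divfK //.
  by rewrite gt_eqF.
have w_unit : diag_mx w^T \in unitmx.
  rewrite unitmxE det_diag unitfE; apply/prodf_neq0 => k _.
  by rewrite mxE gt_eqF.
rewrite -[X in _ *m X]uE mulKmx // [`|q|]mx_normrE.
have qE k : `|q k 0| = `|u k 0| / w k 0.
  by rewrite mxE normrM normfV (gtr0_norm (w_gt0 _ _)).
split=> [q_le k|u_le].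
  rewrite -ler_pdivrMr // -qE; apply: le_trans q_le.
  exact: (@le_bigmax _ _ _ 0 (fun ij => `|q ij.1 ij.2|) (k, 0)).
apply: bigmax_le => // -[k j] _ /=.
by rewrite ord1 qE ler_pdivrMr.
Qed.

(** * Slopes at time zero and along rays *)

Section Slopes.
Context {R : realType} {n m : nat}.
Variables (f : 'rV[R]_n -> 'rV[R]_n) (B : 'M[R]_(n, m)).

(** [a] starts at the gap and stays below it, so the right difference quotients compare; those of
    the gap converge by the one-sided derivative in [trajectory]. *)
Lemma trajectory_slope_le x y k (a : R -> R) da :
  trajectory f x -> trajectory f y ->
  a 0 = ecoord B k (y 0 - x 0) ->
  (forall t : R, 0 < t -> a t <= ecoord B k (y t - x t)) ->
  is_derive (0 : R) 1 a da ->
  da <= ecoord B k (f (y 0) - f (x 0)).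
Proof.
move=> [_ [_ x0]] [_ [_ y0]] a0 a_le /is_derive_cvg/cvg_dnbhs_at_right a_cvg.
pose q (t : R) : R := ecoord B k (t^-1 *: (y t - y 0) - t^-1 *: (x t - x 0)).
have yx : q t @[t --> 0^'+] --> ecoord B k (f (y 0) - f (x 0)).
  exact: (cvg_comp _ _ (cvgB y0 x0) (@continuous_ecoord R n m B k _)).
apply: (ler_cvg_to a_cvg yx); near=> t.
have t_gt0 : 0 < t by near: t; exact: nbhs_right_gt.
rewrite /q -scalerBr ecoordZ [_ *: _]mulrC [leRHS]mulrC ler_pM2r ?invr_gt0 //.
rewrite [t *: 1]mulr1 addr0 a0 !ecoordB.
rewrite [in leRHS]opprD [leRHS]addrACA -opprD lerD2r -ecoordB.
exact: a_le.
Unshelve. all: by end_near. Qed.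

Lemma jacobian_slope_ge p w k C : differentiable f p ->
  (forall h : R, 0 < h -> h * C <= ecoord B k (f (p + h *: w) - f p)) ->
  C <= ecoord B k (w *m jacobian f p).
Proof.
move=> df hC; rewrite -deriveEjacobian //.
have /is_derive_cvg : is_derive p w f ('D_w f p).
  by split => //; apply: diff_derivable.
move=> fdf; have /cvg_dnbhs_at_right fw :=
  cvg_comp _ _ fdf (@continuous_ecoord R n m B k ('D_w f p)).
rewrite -(cvg_lim _ fw) //; apply: limr_ge.
  by apply/cvg_ex; eexists; exact: fw.
near=> h; rewrite /= ecoordZ.
have h_gt0 : 0 < h by near: h; exact: nbhs_right_gt.
by rewrite ler_pdivlMl // [h *: w + p]addrC hC.
Unshelve. all: by end_near. Qed.
End Slopes.

(** * Orientation of the edges and the two equivalences *)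

(** Edge [k] contributes [v tl 0 - v hd 0], and [in_IE] excludes ties. *)
Lemma Bv_pos {R : realType} {n m : nat}
  (E : 'I_m -> 'I_n * 'I_n) (v : 'cV[R]_n) :
  in_IE E v -> mx_pos ((Bv E v)^T *m v).
Proof.
move=> vE k j; rewrite ord1 mxE.
pose lt_ba := v (E k).2 0 < v (E k).1 0.
pose tl := if lt_ba then (E k).1 else (E k).2.
pose hd := if lt_ba then (E k).2 else (E k).1.
have v_lt : v hd 0 < v tl 0.
  rewrite /hd /tl; case: ifPn => //; rewrite -leNgt => v_le.
  by rewrite lt_neqAle vE.
have tl_hd : hd != tl by apply: contraTneq v_lt => ->; rewrite ltxx.
rewrite (bigD1 tl) //= (bigD1 hd) //= big1 => [|i /andP[itl ihd]]; last first.
  by rewrite !mxE /= -/lt_ba -/tl -/hd (negPf itl) (negPf ihd) mul0r.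
rewrite !mxE /= -/lt_ba -/tl -/hd eqxx (negPf tl_hd) eqxx.
by rewrite mul1r mulN1r addr0 subr_gt0.
Qed.

Section Equivalences.
Context {R : realType} {n m : nat}.
Variables (f : 'rV[R]_n -> 'rV[R]_n) (B : 'M[R]_(n, m)).
Hypotheses (fC1 : C1 f) (fcomplete : forward_complete f).

Lemma metzler_quasimonotone :
  (forall x, exists P : 'M[R]_m, metzler P /\ B^T *m Dx f x = P *m B^T) <->
  quasimonotone f B.
Proof.
split=> [fP p|qm p]; first exact: (metzler_factorP _ _).1 (fP p).
exact: (metzler_factorP _ _).2 (qm p).
Qed.

Lemma mx_le_ecoord u w :
  mx_le (B^T *m col_of u) (B^T *m col_of w) <->
  forall k, ecoord B k u <= ecoord B k w.
Proof.
split=> [uw k|uw k j].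
  by have := uw k 0; rewrite /col_of !ecoord_tr !trmxK.
by rewrite ord1 /col_of !ecoord_tr !trmxK.
Qed.

(** For trajectories from [p] and [p + h *: z], coordinate [k] of the gap starts at 0 and stays
    nonnegative, so its initial slope is nonnegative; then [h] tends to 0. *)
Lemma quasimonotone_of_monotone :
  (forall x y, trajectory f x -> trajectory f y ->
    (forall k, ecoord B k (x 0) <= ecoord B k (y 0)) ->
    forall t k, 0 <= t -> ecoord B k (x t) <= ecoord B k (y t)) ->
  quasimonotone f B.
Proof.
move=> mono p z k z_ge0 zk0; have [df _] := fC1.
apply: jacobian_slope_ge => // h h_gt0; rewrite mulr0.
have [x [xT x0]] := fcomplete p.
have [y [yT y0]] := fcomplete (p + h *: z).
rewrite -y0 -x0.
apply: (@trajectory_slope_le _ _ _ f B x y k (cst 0)) => //.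
- by rewrite y0 x0 addrC addKr ecoordZ zk0 mulr0.
- move=> t t_gt0; rewrite /cst /= ecoordB subr_ge0.
  apply: mono (ltW t_gt0) => // j.
  by rewrite y0 x0 ecoordD ecoordZ lerDl mulr_ge0 // ltW.
Qed.

Lemma monotone_of_quasimonotone (v : 'rV[R]_n) x y :
  (forall k, 0 < ecoord B k v) -> quasimonotone f B ->
  trajectory f x -> trajectory f y ->
  (forall k, ecoord B k (x 0) <= ecoord B k (y 0)) ->
  forall t k, 0 <= t -> ecoord B k (x t) <= ecoord B k (y t).
Proof.
move=> v_gt0 qm [cx [dx _]] [cy [dy _]].
exact: (@comparison _ _ _ f B v x y (f \o y)).
Qed.

(** Mean values turn the slope bound into [f (Y s) - f (y s) <= S' s *: e] in every edge coordinate,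
    which makes [Y] a supersolution. The estimate is one-sided; exchanging [x] and [y] gives the
    other side. *)
Lemma contraction_of_slope (v e : 'rV[R]_n) c x y r :
  (forall k, 0 < ecoord B k v) -> quasimonotone f B ->
  (forall p k, ecoord B k (e *m jacobian f p) <= - c * ecoord B k e) ->
  trajectory f x -> trajectory f y -> 0 <= r ->
  (forall k, ecoord B k (x 0 - y 0) <= r * ecoord B k e) ->
  forall t k, 0 <= t ->
    ecoord B k (x t - y t) <= r * expR (- c * t) * ecoord B k e.
Proof.
move=> v_gt0 qm slope [cx [dx _]] [cy [dy _]] r_ge0 xy0 t k t_ge0.
have [df _] := fC1.
pose S (s : R) : R := r * expR (- c * (s - 0)).
have S_ge0 s : 0 <= S s by rewrite mulr_ge0 // expR_ge0.
pose Y s := y s + S s *: e.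
pose S' (s : R) : R := - c * S s.
have dS (s : R) : is_derive s 1 S (S' s) := is_derive_expR_affine r (- c) 0 s.
have cS : continuous S by move=> s; exact: is_derive_continuous (dS s).
pose dY s := f (y s) + S' s *: e.
have -> : r * expR (- c * t) = S t by rewrite /S subr0.
rewrite ecoordB lerBlDl -ecoordZ -ecoordD.
apply: (@comparison _ _ _ f B v x Y dY) => // [|s s_gt0|s j s_gt0|j].
- apply: within_continuousD => //; apply: continuous_subspaceT => s.
  by apply: cvgZr_tmp; exact: cS.
- exact: is_deriveD (dy s s_gt0) (is_derive_scaler S e s _ (dS s)).
- have [s' _ fY] := ecoord_mean_value f B j (y s) (S s *: e) df.
  rewrite /dY ecoordD -lerBlDl -ecoordB fY -scalemxAl !ecoordZ.
  by rewrite /S' [- c * S s]mulrC -[leRHS]mulrA ler_wpM2l.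
- by rewrite /Y ecoordD ecoordZ -lerBlDl -ecoordB /S subr0 mulr0 expR0 mulr1.
Qed.

(** The slope lemmas give lower bounds, hence the start at [p + h *: - e]: the gap is [- h *: e] at
    time 0, and contraction bounds it below by a multiple of [e] whose initial slope is [c * h]. *)
Lemma slope_of_contraction (e : 'rV[R]_n) c :
  (forall x y r, trajectory f x -> trajectory f y -> 0 <= r ->
    (forall k, `|ecoord B k (x 0 - y 0)| <= r * ecoord B k e) ->
    forall t k, 0 <= t ->
      `|ecoord B k (x t - y t)| <= r * expR (- c * t) * ecoord B k e) ->
  (forall k, 0 < ecoord B k e) ->
  forall p k, ecoord B k (e *m jacobian f p) <= - c * ecoord B k e.
Proof.
move=> contr e_gt0 p k; have [df _] := fC1.
rewrite -lerN2 mulNr opprK -[leRHS]mulN1r -[leRHS]ecoordZ scalemxAl scaleN1r.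
apply: jacobian_slope_ge => // h h_gt0.
have [x [xT x0]] := fcomplete p.
have [y [yT y0]] := fcomplete (p + h *: - e).
rewrite -y0 -x0.
have yx0 : y 0 - x 0 = - h *: e by rewrite x0 y0 addrC addKr scalerN scaleNr.
apply: (@trajectory_slope_le _ _ _ f B x y k
  (fun t => - (h * ecoord B k e) * expR (- c * (t - 0)))) => //.
- by rewrite yx0 ecoordZ subr0 mulr0 expR0 mulr1 mulNr.
- move=> t t_gt0; rewrite subr0 ecoordBC [leLHS]mulNr lerN2.
  rewrite mulrAC; apply: le_trans (ler_norm _) _; apply: contr => //.
  + exact: ltW.
  + move=> j; rewrite ecoordBC normrN yx0 ecoordZ mulNr normrN ger0_norm //.
    by rewrite mulr_ge0 // ltW.
  + exact: ltW.
- have := is_derive_expR_affine (- (h * ecoord B k e)) (- c) 0 0.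
  by rewrite subr0 mulr0 expR0 mulr1 mulrNN mulrCA.
Qed.
End Equivalences.

End MonotoneFlows.

(** * Transfer to the incidence matrix and weighted norms *)

Theorem theorem4 (R : realType) (n m : nat) (E : 'I_m -> 'I_n * 'I_n)
  (f : 'rV[R]_n -> 'rV[R]_n) (v : 'cV[R]_n) :
  simple_edges E -> graph_connected E ->
  C1 f -> forward_complete f -> shift_invariant f ->
  in_IE E v ->
  let B := Bv E v in
  ((forall x : 'rV[R]_n, exists P : 'M[R]_m,
        metzler P /\ B^T *m Dx f x = P *m B^T)
   <->
   (forall x y : R -> 'rV[R]_n, trajectory f x -> trajectory f y ->
      mx_le (B^T *m col_of (x 0)) (B^T *m col_of (y 0)) ->
      forall t : R, 0 <= t -> mx_le (B^T *m col_of (x t)) (B^T *m col_of (y t))))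
  /\
  ((forall x : 'rV[R]_n, exists P : 'M[R]_m,
        metzler P /\ B^T *m Dx f x = P *m B^T) ->
   forall (c : R) (e : 'cV[R]_n), mx_pos (B^T *m e) ->
   ((forall x : 'rV[R]_n, mx_le (B^T *m Dx f x *m e) (- c *: (B^T *m e)))
    <->
    (forall x y : R -> 'rV[R]_n, trajectory f x -> trajectory f y ->
      forall t : R, 0 <= t ->
        wnorm (B^T *m e) (B^T *m col_of (x t) - B^T *m col_of (y t))
        <= expR (- c * t) *
           wnorm (B^T *m e) (B^T *m col_of (x 0) - B^T *m col_of (y 0))))).
Proof.
move=> _ _ fC1 fcomplete _ vE B.
(* [v] itself is interior to the cone and serves as the direction of perturbation. *)
have v_gt0 k : 0 < ecoord B k v^T by rewrite -ecoord_tr; exact: Bv_pos.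
split; first split.
- move=> /metzler_quasimonotone qm x y xT yT /mx_le_ecoord xy0 t t_ge0.
  apply/mx_le_ecoord => k.
  exact: (monotone_of_quasimonotone f B fC1 v^T).
- move=> mono; apply/metzler_quasimonotone.
  apply: quasimonotone_of_monotone => // x y xT yT /mx_le_ecoord xy0 t k t_ge0.
  by move: k; apply/mx_le_ecoord; exact: mono.
move=> /metzler_quasimonotone qm c e e_gt0.
have e_gt0' k : 0 < ecoord B k e^T by rewrite -ecoord_tr.
have wnormP u w r : 0 <= r ->
    (wnorm (B^T *m e) (B^T *m col_of u - B^T *m col_of w) <= r) <->
    forall k, `|ecoord B k (u - w)| <= r * ecoord B k e^T.
  move=> r_ge0; rewrite -mulmxBr -linearB /=.
  split=> [/(wnorm_le _ _ _ e_gt0 r_ge0) le_r k|le_r].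
    by have := le_r k; rewrite !ecoord_tr trmxK.
  by apply/wnorm_le => // k; rewrite !ecoord_tr trmxK.
have slopeP : (forall x, mx_le (B^T *m Dx f x *m e) (- c *: (B^T *m e))) <->
    forall p k, ecoord B k (e^T *m jacobian f p) <= - c * ecoord B k e^T.
  have slopeE p k : (B^T *m Dx f p *m e) k 0 = ecoord B k (e^T *m jacobian f p).
    by rewrite -mulmxA ecoord_tr trmx_mul trmxK.
  split=> [slope p k|slope p k j].
    by have := slope p k 0; rewrite slopeE [X in _ <= X]mxE ecoord_tr.
  by rewrite ord1 slopeE [X in _ <= X]mxE ecoord_tr.
split=> [/slopeP slope x y xT yT t t_ge0|contr].
  set r := wnorm _ (B^T *m col_of (x 0) - _).
  have r_ge0 : 0 <= r by exact: normr_ge0.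
  have xy0 := (wnormP (x 0) (y 0) r r_ge0).1 (lexx _).
  apply/(wnormP (x t) (y t)); first by rewrite mulr_ge0 // expR_ge0.
  (* The two halves of the absolute value are the one-sided estimates for [y - x] and [x - y]. *)
  move=> k; rewrite [expR _ * r]mulrC ler_norml lerNl -ecoordBC.
  apply/andP; split; apply: (contraction_of_slope f B fC1 v^T e^T c) => // j.
    by rewrite ecoordBC; apply: le_trans (ler_norm _) _; rewrite normrN.
  by apply: le_trans (ler_norm _) _.
apply/slopeP; apply: slope_of_contraction => // x y r xT yT r_ge0 xy0 t k t_ge0.
move: k; apply/(wnormP (x t) (y t)); first by rewrite mulr_ge0 // expR_ge0.
apply: le_trans (contr x y xT yT t t_ge0) _.
rewrite mulrC ler_wpM2r ?expR_ge0 //; exact/(wnormP (x 0) (y 0)).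
Qed.
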